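(* If $r,s \geq 1$, then \[ \mathcal{D}_{r,s} = 2^{\varepsilon_2} \cdot 3 \cdot \prod_{\substack{p \text{ prime},\ 5 \leq p \leq r+s+1 \\ \langle r\rangle_{p-1}+\langle s\rangle_{p-1} \geq p-1}} p, \] where $\varepsilon_2 = 1$ if ($r=1$ or $s=1$) and $r \neq s$, and $\varepsilon_2 = 0$ otherwise. Moreover, for all $n \geq 0$, $\mathcal{D}_{n,0} = \mathcal{D}_{0,n} = \mathbf{D}_n$. In particular, $\mathcal{D}_{r,s}$ is squarefree for all $r,s \geq 0$ and $\mathcal{D}_{r,s} = \mathcal{D}_{s,r}$ for all $r,s\ge 0$.
   Context: The Bernoulli numbers $\mathbf{B}_n$ are defined by $\frac{t}{e^t-1} = \sum_{n \geq 0} \mathbf{B}_n \frac{t^n}{n!}$ (so $\mathbf{B}_1 = -\tfrac12$). For integers $r,s \geq 0$ define $\mathcal{B}_{r,s} = \sum_{\nu=0}^{r} \binom{r}{\nu} \mathbf{B}_{s+\nu}$. For a rational $q$, $\operatorname{denom}(q)$ is the smallest positive integer $d$ with $dq \in \mathbb{Z}$. Let $\mathcal{D}_{r,s} = \operatorname{denom}(\mathcal{B}_{r,s})$ and $\mathbf{D}_n = \operatorname{denom}(\mathbf{B}_n)$. For integers $x$ and $m \geq 1$, $\langle x\rangle_m$ denotes the least positive residue of $x$ modulo $m$, i.e. the unique element of $\{1,\dots,m\}$ congruent to $x$ mod $m$. The letter $p$ denotes primes. *)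

(* Defs.v *)
From mathcomp Require Import all_boot all_order all_algebra.

Set Implicit Arguments.
Unset Strict Implicit.
Unset Printing Implicit Defensive.

Import Order.TTheory GRing.Theory Num.Theory.
Local Open Scope ring_scope.

(* Formal power series over rat are coefficient sequences [nat -> rat]. *)

Definition fps_mul (f g : nat -> rat) (n : nat) : rat :=
  \sum_(i < n.+1) f (n - i)%N * g i.

(* First n coefficients of 1 / f, obtained by solving f * g = 1 degree by
   degree; meaningful when f 0 != 0. *)
Fixpoint fps_inv_seq (f : nat -> rat) (n : nat) : seq rat :=
  if n is m.+1 then
    let s := fps_inv_seq f m in
    rcons s (((m == 0%N)%:R - \sum_(i < m) f (m - i)%N * s`_i) / f 0%N)
  else [::].

Definition fps_inv (f : nat -> rat) (n : nat) : rat := (fps_inv_seq f n.+1)`_n.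

Definition fps_X (n : nat) : rat := (n == 1%N)%:R.

(* e^t - 1 *)
Definition fps_expB1 (n : nat) : rat :=
  if n is 0%N then 0 else (n`!)%:R^-1.

(* t / (e^t - 1) is computed as the reciprocal of (e^t - 1) / t, whose
   coefficients are those of e^t - 1 shifted by one; see
   [bernoulli_num_gen] and [bernoulli_num_unique]. *)
Definition bernoulli_num (n : nat) : rat :=
  (n`!)%:R * fps_inv (fun k => fps_expB1 k.+1) n.

Definition bernoulli_rs (r s : nat) : rat :=
  \sum_(0 <= nu < r.+1) 'C(r, nu)%:R * bernoulli_num (s + nu)%N.

(* [denq] is int-valued and positive. *)
Definition denom (q : rat) : nat := `|denq q|%N.

Definition denom_rs (r s : nat) : nat := denom (bernoulli_rs r s).

(* Least positive residue: the element of {1, ..., m} congruent to x mod m,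
   for m >= 1. *)
Definition lpres (x : int) (m : nat) : nat := `|((x - 1) %% m)%Z|%N.+1.

Definition squarefree (n : nat) : Prop :=
  forall d : nat, (d ^ 2 %| n)%N -> d = 1%N.

Definition eps2 (r s : nat) : nat :=
  (if ((r == 1) || (s == 1)) && (r != s) then 1 else 0)%N.

Lemma size_fps_inv_seq f n : size (fps_inv_seq f n) = n.
Proof. by elim: n => //= n IH; rewrite size_rcons IH. Qed.

Lemma nth_fps_inv_seq f n i : (i < n)%N -> (fps_inv_seq f n)`_i = fps_inv f i.
Proof.
elim: n => // n IH; rewrite ltnS leq_eqVlt => /orP[/eqP -> //|lt_in].
by rewrite /= nth_rcons size_fps_inv_seq lt_in IH.
Qed.

Lemma fps_invE f n :
  fps_inv f n = ((n == 0%N)%:R - \sum_(i < n) f (n - i)%N * fps_inv f i) / f 0%N.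
Proof.
rewrite /fps_inv /= nth_rcons size_fps_inv_seq ltnn eqxx.
by congr ((_ - _) / _); apply: eq_bigr => i _; rewrite nth_fps_inv_seq.
Qed.

Lemma fps_mulV f n : f 0%N != 0 -> fps_mul f (fps_inv f) n = (n == 0%N)%:R.
Proof.
move=> f0; rewrite /fps_mul big_ord_recr /= subnn [fps_inv f n]fps_invE.
by rewrite mulrC divfK // addrC subrK.
Qed.

(* (e^t - 1) * (sum_n B_n t^n / n!) = t *)
Lemma bernoulli_num_gen :
  fps_mul fps_expB1 (fun n => bernoulli_num n / (n`!)%:R) =1 fps_X.
Proof.
case=> [|n]; first by rewrite /fps_mul big_ord1 /= mul0r.
rewrite /fps_mul big_ord_recr /= subnn mul0r addr0.
have := @fps_mulV (fun k => fps_expB1 k.+1) n isT.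
rewrite /fps_X eqSS => <-; rewrite /fps_mul.
apply: eq_bigr => i _; rewrite subSn -1?ltnS // /bernoulli_num.
by rewrite mulrAC divff ?mul1r // pnatr_eq0 -lt0n fact_gt0.
Qed.

Lemma bernoulli_num_unique (B : nat -> rat) :
  fps_mul fps_expB1 (fun n => B n / (n`!)%:R) =1 fps_X -> B =1 bernoulli_num.
Proof.
move=> genB n; elim/ltn_ind: n => n IH.
have := genB n.+1; rewrite -bernoulli_num_gen /fps_mul !big_ord_recr /=.
rewrite !subnn !mul0r !addr0 !subSnn !mul1r.
under eq_bigr => i _ do rewrite (IH i) //.
have fn0 : (n`!)%:R != 0 :> rat by rewrite pnatr_eq0 -lt0n fact_gt0.
by move/addrI/(mulIf (invr_neq0 fn0)).
Qed.

Lemma denomP (q : rat) :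
  [/\ (0 < denom q)%N, (denom q)%:R * q \is a Num.int
    & forall d : nat, (0 < d)%N -> d%:R * q \is a Num.int -> (denom q <= d)%N].
Proof.
have dE : (denom q)%:R = (denq q)%:~R :> rat.
  by rewrite /denom pmulrn absz_denq.
split; first by rewrite absz_gt0 denq_eq0.
  by rewrite dE mulrC -numqE intr_int.
move=> d d0 /intrP[z dq]; apply: dvdn_leq => //.
have q0 : (denq q)%:~R != 0 :> rat by rewrite intr_eq0 denq_eq0.
have /eqP : d%:Z * numq q = z * denq q.
  apply/eqP; rewrite -(eqr_int rat) !rmorphM /= -dq numqE -pmulrn.
  by rewrite mulrA.
move/eqP=> E; have : (denq q %| d%:Z * numq q)%Z by rewrite E dvdz_mull.
rewrite Gauss_dvdzl //; by rewrite coprimezE coprime_sym; exact: coprime_num_den.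
Qed.

Lemma lpresP (x : int) (m k : nat) : (0 < m)%N ->
  lpres x m = k <-> [/\ (0 < k)%N, (k <= m)%N & (k%:Z = x %[mod m])%Z].
Proof.
move=> m0; have mz : m%:Z != 0 by rewrite eqz_nat -lt0n.
have rE : `|((x - 1) %% m)%Z|%N%:Z = ((x - 1) %% m)%Z.
  by rewrite gez0_abs // modz_ge0.
split=> [<-|[]].
  split=> //; first by rewrite -ltz_nat /lpres rE ltz_pmod.
  by rewrite /lpres intS rE modzDmr addrC subrK.
case: k => // k _ km /eqP E; congr _.+1; apply/eqP; rewrite -eqz_nat rE.
have /eqP -> : (x - 1 == k%:Z %[mod m])%Z.
  by rewrite eq_sym -(eqz_modDl 1) -intS addrC subrK.
by rewrite modz_small.
Qed.

(* Main.v *)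
(* Let L be the linear functional on rat[X] sending X^n to the n-th Bernoulli
   number, so that B_(r,s) = L((X + 1)^r X^s). It is characterised by
   L(f(X + 1)) - L(f) = f'(0). As f |-> L(f(-1 - X)) has the same property, L is
   invariant under X |-> -1 - X, hence B_(r,s) = (-1)^(r+s) B_(s,r).
   Telescoping expresses the power sums over a < p through Bernoulli numbers;
   it follows that p B_m is p-integral and, for p odd, congruent mod p to the
   sum of the a^m. So p^2 never divides the denominator, and an odd p divides
   it exactly when S = \sum_(x in F_p) (x + 1)^r x^s is nonzero. Once r and s
   are replaced by their residues r', s' in {1, ..., p-1}, only the monomials of
   degree p - 1 and 2(p - 1) contribute: -S = C(r', p-1-s') + [r' = s' = p-1],
   which is nonzero mod p iff r' + s' >= p - 1. For p = 2 the same recursion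
   gives 2 B_m mod 2 (it is 1 for m = 1 and for even m > 0, and 0 otherwise), and
   the sum of C(r, k) over k of a given parity is 2^(r-1). *)

Require Import Defs.
From HB Require Import structures.
From mathcomp Require Import all_boot all_order all_algebra.
From mathcomp Require Import ring zify.
From mathcomp Require Import finfield.

Set Implicit Arguments.
Unset Strict Implicit.
Unset Printing Implicit Defensive.

Import Order.TTheory GRing.Theory Num.Theory.
Local Open Scope ring_scope.

(** * Denominators, [p]-integral rationals and congruences modulo [p] *)

Lemma intr_mul_denom (q : rat) (d : nat) :
  (d%:R * q \is a Num.int) = (denom q %| d)%N.
Proof.
have dE : (denom q)%:R = (denq q)%:~R :> rat by rewrite /denom pmulrn absz_denq.
have q0 : (denq q)%:~R != 0 :> rat by rewrite intr_eq0 denq_eq0.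
apply/idP/idP => [/intrP[z dq]|/dvdnP[k ->]]; last first.
  by rewrite natrM -mulrA dE [_%:~R * q]mulrC -numqE rpredM ?intr_int ?rpred_nat.
have E : d%:Z * numq q = z * denq q.
  by apply/eqP; rewrite -(eqr_int rat) !rmorphM /= -dq numqE -pmulrn mulrA.
have : (denq q %| d%:Z * numq q)%Z by rewrite E dvdz_mull.
by rewrite Gauss_dvdzl // coprimezE coprime_sym coprime_num_den.
Qed.

Lemma denom_gt0 (q : rat) : (0 < denom q)%N.
Proof. by rewrite absz_gt0 denq_eq0. Qed.

Lemma denomN (q : rat) : denom (- q) = denom q.
Proof. by rewrite /denom denqN. Qed.

(** For prime [p] this is membership in the localisation of the integers at [p]. It is locked so
    that conversion does not unfold it to a computation of [denom]. *)
HB.lock Definition pintegral (p : nat) (q : rat) : bool := ~~ (p %| denom q)%N.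

Definition pcong (p : nat) (x y : rat) : bool := pintegral p ((x - y) / p%:R).

Section PIntegral.

Variable p : nat.
Hypothesis p_pr : prime p.

Let p_neq0 : p%:R != 0 :> rat.
Proof. by rewrite pnatr_eq0 -lt0n prime_gt0. Qed.

Lemma pintegralE (q : rat) : pintegral p q = ~~ (p %| denom q)%N.
Proof. by rewrite pintegral.unlock. Qed.

Lemma pintegralP (q : rat) :
  reflect (exists2 d : nat, ~~ (p %| d)%N & d%:R * q \is a Num.int)
          (pintegral p q).
Proof.
rewrite pintegralE; apply: (iffP idP) => [pq|[d pd]].
  by exists (denom q); rewrite ?intr_mul_denom.
by rewrite intr_mul_denom => dq; apply: contra pd => /dvdn_trans; apply.
Qed.

Lemma pintegral_int (q : rat) : q \is a Num.int -> pintegral p q.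
Proof.
by move=> qz; apply/pintegralP; exists 1%N; rewrite ?mul1r // dvdn1 neq_ltn prime_gt1 ?orbT.
Qed.

Lemma pintegral_nat (n : nat) : pintegral p n%:R.
Proof. by rewrite pintegral_int ?rpred_nat. Qed.

Lemma pintegralN (x : rat) : pintegral p (- x) = pintegral p x.
Proof. by rewrite !pintegralE denomN. Qed.

Lemma pintegralD (x y : rat) :
  pintegral p x -> pintegral p y -> pintegral p (x + y).
Proof.
move=> /pintegralP[d pd dx] /pintegralP[e pe ey]; apply/pintegralP.
exists (d * e)%N; first by rewrite Euclid_dvdM // negb_or pd.
rewrite natrM mulrDr {1}[d%:R * _]mulrC -!mulrA.
by rewrite rpredD // rpredM // rpred_nat.
Qed.

Lemma pintegralB (x y : rat) :
  pintegral p x -> pintegral p y -> pintegral p (x - y).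
Proof. by move=> px py; rewrite pintegralD ?pintegralN. Qed.

Lemma pintegralM (x y : rat) :
  pintegral p x -> pintegral p y -> pintegral p (x * y).
Proof.
move=> /pintegralP[d pd dx] /pintegralP[e pe ey]; apply/pintegralP.
exists (d * e)%N; first by rewrite Euclid_dvdM // negb_or pd.
by rewrite natrM mulrACA rpredM.
Qed.

Lemma pintegral_sum (I : Type) (r : seq I) (P : pred I) (F : I -> rat) :
  (forall i, P i -> pintegral p (F i)) -> pintegral p (\sum_(i <- r | P i) F i).
Proof.
by move=> pF; elim/big_ind: _ => //; [exact: pintegral_nat 0 | exact: pintegralD].
Qed.

Lemma pintegral_natV (n : nat) : ~~ (p %| n)%N -> pintegral p (n%:R^-1).
Proof.
move=> pn; apply/pintegralP; exists n => //; rewrite divff ?rpred1 //.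
by apply: contraNneq pn => /eqP; rewrite pnatr_eq0 => /eqP ->; rewrite dvdn0.
Qed.

Lemma pintegral_nat_div (n : nat) : pintegral p (n%:R / p%:R) = (p %| n)%N.
Proof.
apply/idP/idP => [/pintegralP[d pd /intrP[z]]|/dvdnP[k ->]]; last first.
  by rewrite natrM mulfK ?pintegral_nat.
rewrite mulrA => /(canRL (divfK p_neq0)) /eqP.
rewrite -natrM !pmulrn -intrM eqr_int => /eqP E.
have : (p %| d * n)%N by rewrite -[(p %| _)%N]/(p%:Z %| (d * n)%N%:Z)%Z E dvdz_mull.
by rewrite Euclid_dvdM // (negPf pd).
Qed.

Lemma pintegral_expn_div (e n : nat) :
  (0 < n)%N -> (logn p n <= e)%N -> pintegral p ((p ^ e)%:R / n%:R).
Proof.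
move=> n0 len; have [u pu nE] := pfactor_coprime p_pr n0.
rewrite nE natrM invfM mulrCA pintegralM //.
  by rewrite pintegral_natV // -prime_coprime.
rewrite -[in X in pintegral _ X](subnK len) expnD natrM mulfK ?pintegral_nat //.
by rewrite natrX expf_neq0.
Qed.

Lemma pcong_refl (x : rat) : pcong p x x.
Proof. by rewrite /pcong subrr mul0r (pintegral_nat 0). Qed.

Lemma pcongD (x x' y y' : rat) :
  pcong p x x' -> pcong p y y' -> pcong p (x + y) (x' + y').
Proof. by rewrite /pcong => px py; rewrite opprD addrACA mulrDl pintegralD. Qed.

Lemma pcongB (x x' y y' : rat) :
  pcong p x x' -> pcong p y y' -> pcong p (x - y) (x' - y').
Proof.
rewrite /pcong => px py.
have -> : x - y - (x' - y') = (x - x') - (y - y') by ring.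
by rewrite mulrBl pintegralB.
Qed.

Lemma pcongMl (z x y : rat) :
  pintegral p z -> pcong p x y -> pcong p (z * x) (z * y).
Proof. by rewrite /pcong => pz pxy; rewrite -mulrBr -mulrA pintegralM. Qed.

Lemma pcong_trans (y x z : rat) : pcong p x y -> pcong p y z -> pcong p x z.
Proof.
by rewrite /pcong => pxy pyz; rewrite -(subrK y x) -addrA mulrDl pintegralD.
Qed.

Lemma pcong_sum (I : Type) (r : seq I) (P : pred I) (F G : I -> rat) :
  (forall i, P i -> pcong p (F i) (G i)) ->
  pcong p (\sum_(i <- r | P i) F i) (\sum_(i <- r | P i) G i).
Proof.
by move=> pFG; elim/big_ind2: _ => // *; [exact: pcong_refl | exact: pcongD].
Qed.

Lemma pcong_subl (x : rat) (n : nat) : (p %| n)%N -> pcong p (x - n%:R) x.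
Proof. by move=> pn; rewrite /pcong addrAC subrr sub0r mulNr pintegralN pintegral_nat_div. Qed.

(** Dividing the congruence by [p] shows that [q] and [n / p] differ by a [p]-integral number. *)
Lemma pintegral_pcong (q : rat) (n : nat) :
  pcong p (p%:R * q) n%:R -> pintegral p q = (p %| n)%N.
Proof.
rewrite /pcong mulrBl mulrAC mulfV // mul1r -pintegral_nat_div => pqn.
apply/idP/idP => [pq|pn].
  by rewrite -pintegralN -[- _](addKr q) addrC pintegralB.
by rewrite -(subrK (n%:R / p%:R) q) pintegralD.
Qed.

(** The denominator divides [d * p] for some [d] prime to [p], so its exponent at [p] is 0 or 1, and
    it is 0 exactly for [p]-integral [q]. *)
Lemma logn_denom (q : rat) :
  pintegral p (p%:R * q) -> logn p (denom q) = ~~ pintegral p q.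
Proof.
move=> /pintegralP[d pd]; rewrite mulrA -natrM intr_mul_denom => qd.
have d0 : (0 < d)%N by case: d pd {qd} => //; rewrite dvdn0.
have : (logn p (denom q) <= 1)%N.
  apply: leq_trans (dvdn_leq_log p _ qd) _; first by rewrite muln_gt0 d0 prime_gt0.
  rewrite lognM ?(prime_gt0 p_pr) // (logn_prime p p_pr) eqxx.
  by rewrite logn_coprime // prime_coprime.
have := pfactor_dvdn 1 p_pr (denom_gt0 q); rewrite expn1 pintegralE negbK => ->.
by case: (logn _ _) => [|[]].
Qed.

End PIntegral.

(** * The binomial recursion that characterises the Bernoulli numbers *)

Lemma fps_mul_expB1 (b : nat -> rat) (n : nat) :
  fps_mul fps_expB1 (fun k => b k / (k`!)%:R) n =
  (\sum_(i < n) 'C(n, i)%:R * b i) / (n`!)%:R.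
Proof.
rewrite /fps_mul big_ord_recr /= subnn mul0r addr0 mulr_suml.
apply: eq_bigr => i _; have /ltnW in_ := ltn_ord i.
have -> : fps_expB1 (n - i) = (((n - i)`!)%:R)^-1.
  by have := ltn_ord i; rewrite -subn_gt0; case: (n - i)%N.
rewrite -(bin_fact in_) !natrM.
by field; rewrite !pnatr_eq0 -!lt0n !fact_gt0 bin_gt0.
Qed.

Lemma fps_XE (n : nat) : fps_X n = (n == 1%N)%:R / (n`!)%:R.
Proof. by rewrite /fps_X; case: eqP => [->|_]; rewrite ?mul0r ?divr1. Qed.

Lemma natr_fact_neq0 (n : nat) : (n`!)%:R != 0 :> rat.
Proof. by rewrite pnatr_eq0 -lt0n fact_gt0. Qed.

Lemma bernoulli_num_sum (n : nat) :
  \sum_(i < n) 'C(n, i)%:R * bernoulli_num i = (n == 1%N)%:R.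
Proof.
have := bernoulli_num_gen n; rewrite fps_mul_expB1 fps_XE.
by move/(mulIf (invr_neq0 (natr_fact_neq0 n))).
Qed.

Lemma bernoulli_num_sum_unique (b : nat -> rat) :
  (forall n, \sum_(i < n) 'C(n, i)%:R * b i = (n == 1%N)%:R) ->
  b =1 bernoulli_num.
Proof.
by move=> bP; apply: bernoulli_num_unique => n; rewrite fps_mul_expB1 fps_XE bP.
Qed.

Lemma bernoulli_num0 : bernoulli_num 0 = 1.
Proof. by have := bernoulli_num_sum 1; rewrite big_ord1 mul1r. Qed.

(** * The functional [L] on polynomials, its shift formula and its reflection *)

Definition umbral (f : {poly rat}) : rat :=
  \sum_(i < size f) f`_i * bernoulli_num i.

(** Linearity compares polynomials of different sizes, so their sums have to be brought to a common
    range. *)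
Lemma umbral_widen (n : nat) (f : {poly rat}) :
  (size f <= n)%N -> umbral f = \sum_(i < n) f`_i * bernoulli_num i.
Proof.
move=> fn; rewrite /umbral (big_ord_widen n (fun i => f`_i * bernoulli_num i)) //.
rewrite big_mkcond; apply: eq_bigr => i _; case: ltnP => // fi.
by rewrite nth_default ?mul0r.
Qed.

Lemma umbral_is_linear : scalar umbral.
Proof.
move=> a f g; pose n := maxn (size f) (size g).
have fn : (size f <= n)%N by rewrite leq_maxl.
have gn : (size g <= n)%N by rewrite leq_maxr.
have afgn : (size (a *: f + g)%R <= n)%N.
  by rewrite (leq_trans (size_polyD _ _)) // geq_max gn (leq_trans (size_scale_leq _ _)).
rewrite !(umbral_widen (n := n)) // mulr_sumr -big_split /=.
by apply: eq_bigr => i _; rewrite coefD coefZ mulrDl mulrA.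
Qed.

HB.instance Definition _ :=
  GRing.isLinear.Build rat {poly rat} rat *%R umbral umbral_is_linear.

Lemma umbralXn (n : nat) : umbral 'X^n = bernoulli_num n.
Proof.
rewrite /umbral size_polyXn big_ord_recr /= coefXn eqxx mul1r big1 ?add0r // => i _.
by rewrite coefXn ltn_eqF ?mul0r.
Qed.

Lemma umbral_comp (f g : {poly rat}) :
  umbral (f \Po g) = \sum_(i < size f) f`_i * umbral (g ^+ i).
Proof. by rewrite comp_polyE linear_sum; apply: eq_bigr => i _; rewrite linearZ. Qed.

Lemma umbral_XaddC (n : nat) (c : rat) :
  umbral (('X + c%:P) ^+ n) = \sum_(i < n.+1) 'C(n, i)%:R * (c ^+ (n - i) * bernoulli_num i).
Proof.
rewrite addrC exprDn linear_sum; apply: eq_bigr => i _.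
by rewrite linearMn -polyC_exp mul_polyC linearZ /= umbralXn mulr_natl.
Qed.

(** On ['X^n] the lower terms of the expansion of [('X + 1) ^+ n] sum to 1 if [n = 1] and to 0
    otherwise, by the Bernoulli recursion; this is the derivative of ['X^n] at 0. *)
Lemma umbral_shift (f : {poly rat}) :
  umbral (f \Po ('X + 1)) = umbral f + f^`().[0].
Proof.
rewrite horner_coef0 coef_deriv mulr1n umbral_comp [umbral f]/umbral.
(* The coefficient is spread over a sum so that both sides can be compared term by term. *)
have -> : f`_1 = \sum_(i < size f) f`_i * (i == 1%N :> nat)%:R.
  have [s1|s1] := ltnP 1 (size f).
    rewrite (bigD1 (Ordinal s1)) //= mulr1 big1 ?addr0 // => i.
    by rewrite -val_eqE /= => /negPf ->; rewrite mulr0.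
  rewrite nth_default // big1 // => i _.
  by rewrite ltn_eqF ?mulr0 // (leq_trans (ltn_ord i)).
rewrite -big_split /=; apply: eq_bigr => i _; rewrite -mulrDr; congr (_ * _).
rewrite umbral_XaddC big_ord_recr /= subnn binn !mul1r addrC; congr (_ + _).
by rewrite -bernoulli_num_sum; apply: eq_bigr => j _; rewrite expr1n mul1r.
Qed.

Lemma umbral_shiftn (f : {poly rat}) (n : nat) :
  umbral (f \Po ('X + n%:R%:P)) = umbral f + \sum_(a < n) f^`().[a%:R].
Proof.
elim: n => [|n IH]; first by rewrite big_ord0 !addr0 comp_polyXr.
rewrite big_ord_recr /= addrA -IH.
have -> : f \Po ('X + n.+1%:R%:P) = (f \Po ('X + n%:R%:P)) \Po ('X + 1).
  rewrite -comp_polyA comp_polyD comp_polyX comp_polyC -addrA; congr (f \Po (_ + _)).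
  by rewrite -natr1 addrC polyCD.
rewrite umbral_shift deriv_comp derivD derivX derivC addr0 mulr1.
by rewrite horner_comp hornerD hornerX hornerC add0r.
Qed.

(* The functional f |-> umbral (f \Po (- 1 - 'X)) also satisfies [umbral_shift],
   which determines it. *)
Lemma umbral_reflect (f : {poly rat}) : umbral (f \Po (- 1 - 'X)) = umbral f.
Proof.
pose b n := umbral ((- 1 - 'X) ^+ n).
suff bE : b =1 bernoulli_num.
  by rewrite umbral_comp; apply: eq_bigr => i _; rewrite -bE.
apply: bernoulli_num_sum_unique => n.
(* The binomial expansion of [(1 + (- 1 - 'X)) ^+ n], with its top term [b n] moved to the other
   side. *)
have -> : \sum_(i < n) 'C(n, i)%:R * b i = umbral ((- 'X) ^+ n) - b n.
  have -> : - 'X = 1 + (- 1 - 'X) :> {poly rat} by rewrite addrA subrr add0r.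
  rewrite exprDn linear_sum big_ord_recr /= binn expr1n mul1r addrK.
  by apply: eq_bigr => i _; rewrite expr1n mul1r linearMn mulr_natl.
(* Since [- 1 - 'X] is [- 'X] shifted by 1, the difference is minus the derivative of [(- 'X) ^+ n]
   at 0, which is 1 for [n = 1] and 0 otherwise. *)
have -> : b n = umbral ((- 'X) ^+ n \Po ('X + 1)).
  rewrite /b rmorphXn /= raddfN /= comp_polyX.
  by congr (umbral (_ ^+ n)); rewrite opprD addrC.
rewrite umbral_shift opprD addNKr.
rewrite deriv_exp derivN derivX hornerMn hornerM horner_exp !hornerN hornerX hornerC.
case: n => [|[|n]] //=; rewrite ?expr0 ?mul1r ?opprK //.
by rewrite oppr0 expr0n /= mulr0 mul0rn oppr0.
Qed.

(** * Power sums over finite fields *)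

Lemma sum_natr_Fp (p : nat) (F : 'F_p -> 'F_p) : prime p ->
  \sum_(x : 'F_p) F x = \sum_(a < p) F a%:R.
Proof.
move=> p_pr; rewrite -(big_mkord xpredT (fun a => F a%:R)).
rewrite -(congr1 (index_iota 0) (Fp_cast p_pr)) big_mkord.
by apply: eq_bigr => i _; rewrite natr_Zp.
Qed.

(** Fermat's theorem for nonzero [x]. Positive exponents matter at [x = 0], where [0 ^+ 0 = 1]. *)
Lemma expf_card_mod (F : finFieldType) (x : F) (m n : nat) :
  (0 < m)%N -> (0 < n)%N -> (m = n %[mod #|F|.-1])%N -> x ^+ m = x ^+ n.
Proof.
have [-> m0 n0 _|x0 _ _ E] := eqVneq x 0; first by rewrite !expr0n !gtn_eqF.
have x1 : x ^+ #|F|.-1 = 1.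
  apply: (mulfI x0); rewrite -exprS prednK ?expf_card ?mulr1 //.
  by apply/card_gt0P; exists x.
by rewrite -(expr_mod m x1) E expr_mod.
Qed.

(** If [#|F|.-1] divides [n], every nonzero [x] contributes 1. Otherwise some nonzero [c] has
    [c ^+ n != 1], and the substitution of [c * x] for [x] multiplies the sum by [c ^+ n] without
    changing it. *)
Lemma sum_expf (F : finFieldType) (n : nat) : (0 < n)%N ->
  \sum_(x : F) x ^+ n = - (#|F|.-1 %| n)%:R.
Proof.
move=> n0; have F0 : (1 < #|F|)%N by rewrite card_finNzRing_gt1.
have [dn|ndn] := boolP (_ %| _)%N.
  have xE (x : F) : x ^+ n = 1 - (x == 0)%:R.
    have [->|x0] := eqVneq x 0; first by rewrite expr0n gtn_eqF // subrr.
    rewrite (@expf_card_mod F x n #|F|.-1) //; last 2 first.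
    - by rewrite -subn1 subn_gt0.
    - by rewrite modnn; apply/eqP.
    by rewrite subr0; apply: (mulfI x0); rewrite -exprS prednK ?expf_card ?mulr1 // ltnW.
  under eq_bigr do rewrite xE.
  (* Translation by 1 permutes [F], so it adds [#|F|] to the sum of all elements and yet preserves
     that sum. *)
  have cardF0 : #|F|%:R = 0 :> F.
    apply: (@addrI _ (\sum_(x : F) x)); rewrite addr0 [RHS](reindex_inj (addIr 1)) /=.
    by rewrite big_split /= sumr_const.
  rewrite sumrB sumr_const cardF0 sub0r (bigD1 0) //= eqxx big1 ?addr0 // => x.
  by move/negPf->.
pose m := (n %% #|F|.-1)%N.
have m0 : (0 < m)%N by rewrite lt0n.
have mF : (m < #|F|.-1)%N by rewrite ltn_mod -subn1 subn_gt0.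
(* The polynomial ['X^m - 1] has at most [m] roots, fewer than the number of nonzero elements. *)
have [c /andP[c0 cm1]] : exists c : F, (c != 0) && (c ^+ m != 1).
  apply/existsP; apply: contraTT mF; rewrite negb_exists -leqNgt => /forallP cP.
  rewrite -(cardC1 (0 : F)) cardE; apply: (max_unity_roots m0); last exact: enum_uniq.
  apply/allP => c; rewrite mem_enum inE unity_rootE => c0.
  by have := cP c; rewrite c0 negbK.
apply/eqP; rewrite oppr0; have : c ^+ m * \sum_(x : F) x ^+ n = \sum_(x : F) x ^+ n.
  rewrite [RHS](reindex_inj (mulfI c0)) mulr_sumr; apply: eq_bigr => x _.
  by rewrite exprMn (@expf_card_mod F c n m) // modn_mod.
move/eqP; rewrite -subr_eq0 -[X in _ - X]mul1r -mulrBl mulf_eq0 subr_eq0.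
by rewrite (negPf cm1).
Qed.

(** * Power sums over initial segments and Bernoulli numbers modulo a prime *)

(** This is [umbral_shiftn] for ['X^(m.+1)], expanded and divided by [m.+1]. The factor
    [n%:R * bernoulli_num k] is kept together because for [n = p] prime it is [p]-integral. *)
Lemma sum_powers (n m : nat) :
  \sum_(a < n) (a%:R : rat) ^+ m =
  \sum_(k < m.+1) 'C(m, k)%:R * (n%:R * bernoulli_num k) *
     ((n ^ (m - k))%:R / (m - k).+1%:R).
Proof.
have m0 : m.+1%:R != 0 :> rat by rewrite pnatr_eq0.
apply: (mulfI m0); have := umbral_shiftn 'X^(m.+1) n.
rewrite comp_Xn_poly umbral_XaddC umbralXn big_ord_recr /= subnn binn !mul1r.
rewrite addrC => /addrI E; rewrite mulr_sumr.
transitivity (\sum_(a < n) (('X^(m.+1))^`()).[a%:R] : rat).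
  by apply: eq_bigr => a _; rewrite derivXn hornerMn hornerXn mulr_natl.
rewrite -E mulr_sumr; apply: eq_bigr => k _; have km : (k <= m)%N by rewrite -ltnS.
have := mul_bin_down m.+1 k; rewrite subSn //= => /(congr1 (fun i => i%:R : rat)).
rewrite !natrM => bE.
have mk0 : (m - k).+1%:R != 0 :> rat by rewrite pnatr_eq0.
apply: (mulfI mk0); rewrite !mulrA -bE exprS natrX.
by move: mk0; move: (m - k).+1%:R => d d0; field.
Qed.

Lemma ltn_succ_expn (p j : nat) :
  (1 < p)%N -> (0 < j)%N -> (2 < p)%N || (1 < j)%N -> (j.+1 < p ^ j)%N.
Proof.
move=> p1; elim: j => // j IH _.
case: j IH => [_|j IH _]; first by rewrite orbF expn1.
case: j IH => [|j] IH; first by rewrite expnS expn1; apply: (@leq_mul 2 2).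
by have := IH isT (orbT _); rewrite [(p ^ j.+3)%N]expnS => ?; nia.
Qed.

(** The [p]-part of [j.+1] is at most [j.+1], hence below [p ^ j]. The bound fails for [p = 2],
    [j = 1], which is why the prime 2 is treated apart. *)
Lemma logn_succ_ltn (p j : nat) :
  (1 < p)%N -> (0 < j)%N -> (2 < p)%N || (1 < j)%N -> (logn p j.+1 < j)%N.
Proof.
move=> p1 j0 pj; rewrite -(ltn_exp2l _ _ p1).
by apply: leq_ltn_trans (ltn_succ_expn p1 j0 pj); rewrite dvdn_leq // pfactor_dvdnn.
Qed.

Lemma logn_succ_leq (p j : nat) : (1 < p)%N -> (logn p j.+1 <= j)%N.
Proof.
case: j => [|j] p1; first by rewrite logn1.
rewrite -ltnS -(ltn_exp2l _ _ p1); apply: leq_ltn_trans (ltn_expl _ p1).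
by rewrite dvdn_leq // pfactor_dvdnn.
Qed.

(** Strong induction: [sum_powers] with [n = p] is solved for its top term, and all other terms are
    [p]-integral. *)
Lemma pintegral_bernoulli_num (p m : nat) : prime p ->
  pintegral p (p%:R * bernoulli_num m).
Proof.
move=> p_pr; elim/ltn_ind: m => m IH; have := sum_powers p m.
rewrite big_ord_recr /= subnn expn0 binn divr1 mul1r addrC => /esym/(canRL (addrK _)) ->.
apply: pintegralB => //; apply: pintegral_sum => // i _.
  by rewrite -natrX pintegral_nat.
apply: pintegralM => //; first by rewrite pintegralM ?pintegral_nat ?IH.
by rewrite pintegral_expn_div // logn_succ_leq ?(prime_gt1 p_pr).
Qed.

(** Division by [p] leaves [p ^ (m - k - 1)] over [m - k + 1], so the strict bound on [logn] is
    required. Every term but the top one thus vanishes modulo an odd [p]. *)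
Lemma pintegral_sum_powers_term (p m k : nat) : prime p ->
  (k < m)%N -> (2 < p)%N || (k.+1 < m)%N ->
  pintegral p ('C(m, k)%:R * (p%:R * bernoulli_num k) *
                 ((p ^ (m - k))%:R / (m - k).+1%:R) / p%:R).
Proof.
move=> p_pr km pk; have j0 : (0 < m - k)%N by rewrite subn_gt0.
have p0 : p%:R != 0 :> rat by rewrite pnatr_eq0 -lt0n prime_gt0.
rewrite -mulrA [X in _ * X]mulrAC -[X in (p ^ X)%N](prednK j0) expnSr natrM mulfK //.
apply: pintegralM => //; first by rewrite pintegralM ?pintegral_nat ?pintegral_bernoulli_num.
rewrite pintegral_expn_div // -ltnS prednK // logn_succ_ltn ?(prime_gt1 p_pr) //.
by case/orP: pk => [->//|]; lia.
Qed.

Lemma pcong_bernoulli_num_odd (p m : nat) : prime p -> (2 < p)%N ->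
  pcong p (p%:R * bernoulli_num m) (\sum_(a < p) a%:R ^+ m).
Proof.
move=> p_pr p2; rewrite sum_powers big_ord_recr /= subnn expn0 binn divr1 mul1r.
rewrite /pcong opprD addrCA subrr addr0 mulNr pintegralN mulr_suml.
by apply: pintegral_sum => // k _; rewrite pintegral_sum_powers_term ?p2.
Qed.

Lemma pcong_bernoulli_num2 (m : nat) :
  pcong 2 (2 * bernoulli_num m) ((m == 1%N) || (0 < m)%N && ~~ odd m)%:R.
Proof.
(* In [sum_powers 2 k.+1] the terms of index below [k] vanish modulo 2, but the term of index [k]
   survives as [k.+1%:R * (2 * bernoulli_num k)]; the power sum itself is 1. *)
have rec k : pcong 2 (2 * bernoulli_num k.+1) (1 - k.+1%:R * (2 * bernoulli_num k)).
  have S1 : \sum_(a < 2) (a%:R : rat) ^+ k.+1 = 1.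
    by rewrite 2!big_ord_recr big_ord0 /= expr0n expr1n !add0r.
  rewrite -[X in pcong 2 _ (X - _)]S1 sum_powers 2!big_ord_recr /=.
  rewrite subnn subSnn expn0 expn1 !binn binSn !divr1 mul1r addrAC addrK.
  rewrite /pcong opprD addrCA subrr addr0 mulNr pintegralN mulr_suml.
  apply: pintegral_sum; first by [].
  move=> i _; have ik := ltn_ord i.
  have i2 : (2 < 2)%N || (i.+1 < k.+1)%N by [].
  exact: (@pintegral_sum_powers_term 2 k.+1 i isT (ltnW ik) i2).
elim: m => [|m IH].
  by rewrite /pcong bernoulli_num0 mulr1 subr0 divff // (pintegral_nat _ 1).
apply: pcong_trans (rec m) _ => //.
have step : pcong 2 (1 - m.+1%:R * (2 * bernoulli_num m))
   (1 - m.+1%:R * ((m == 1%N) || (0 < m)%N && ~~ odd m)%:R).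
  by apply: pcongB => //; [exact: pcong_refl|apply: pcongMl => //; exact: pintegral_nat].
apply: pcong_trans step _ => //.
case: m {IH} => [|[|m]] /=.
- by rewrite mulr0 subr0; exact: pcong_refl.
- by rewrite mulr1; exact: pcong_subl.
rewrite negbK; have [om|em] := boolP (odd m); first by rewrite mulr0 subr0; exact: pcong_refl.
have -> : 1 - m.+3%:R * 1 = 0 - m.+2%:R :> rat by rewrite -[m.+3%:R]natr1; ring.
by apply: pcong_subl => //; rewrite dvdn2 /= negbK.
Qed.

(** * Symmetry of [bernoulli_rs] and its integrality at a prime *)

Lemma bernoulli_rs_umbral (r s : nat) :
  bernoulli_rs r s = umbral (('X + 1) ^+ r * 'X^s).
Proof.
rewrite exprD1n mulr_suml linear_sum /bernoulli_rs big_mkord.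
by apply: eq_bigr => i _; rewrite [in RHS]mulrnAl -exprD addnC linearMn /= umbralXn mulr_natl.
Qed.

(** The reflection turns ['X + 1] into [- 'X] and ['X] into [- ('X + 1)], so the two factors trade
    places up to sign. *)
Lemma bernoulli_rsC (r s : nat) :
  bernoulli_rs r s = (-1) ^+ (r + s) * bernoulli_rs s r.
Proof.
rewrite !bernoulli_rs_umbral -umbral_reflect rmorphM !rmorphXn /=.
rewrite raddfD /= rmorph1 comp_polyX.
have -> : - 1 - 'X + 1 = - 'X :> {poly rat} by ring.
have -> : - 1 - 'X = - ('X + 1) :> {poly rat} by ring.
rewrite [(- 'X) ^+ r]exprNn [(- _) ^+ s]exprNn mulrACA -exprD.
have -> : (-1) ^+ (r + s) = ((-1) ^+ (r + s))%:P :> {poly rat}.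
  by rewrite polyC_exp polyCN.
by rewrite mul_polyC linearZ /= [_ * (_ ^+ s)]mulrC.
Qed.

Lemma denom_rsC (r s : nat) : denom_rs r s = denom_rs s r.
Proof.
rewrite /denom_rs bernoulli_rsC -signr_odd.
by case: (odd _); rewrite ?expr0 ?expr1 ?mul1r ?mulN1r ?denomN.
Qed.

Lemma bernoulli_rs0l (n : nat) : bernoulli_rs 0 n = bernoulli_num n.
Proof. by rewrite /bernoulli_rs big_nat1 bin0 mul1r addn0. Qed.

Lemma pintegral_bernoulli_rs_mul (p r s : nat) : prime p ->
  pintegral p (p%:R * bernoulli_rs r s).
Proof.
move=> p_pr; rewrite mulr_sumr; apply: pintegral_sum => // i _.
by rewrite mulrCA pintegralM ?pintegral_nat ?pintegral_bernoulli_num.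
Qed.

(** The function [c] stands for natural representatives of [p%:R * bernoulli_num m] modulo [p]:
    power sums for odd [p], a parity indicator for [p = 2]. *)
Lemma pintegral_bernoulli_rs (c : nat -> nat) (p r s : nat) : prime p ->
  (forall m, pcong p (p%:R * bernoulli_num m) (c m)%:R) ->
  pintegral p (bernoulli_rs r s) =
  (p %| \sum_(k < r.+1) 'C(r, k) * c (s + k))%N.
Proof.
move=> p_pr cP; apply: pintegral_pcong => //.
rewrite mulr_sumr big_mkord natr_sum; apply: pcong_sum => // i _.
by rewrite mulrCA natrM; apply: pcongMl => //; exact: pintegral_nat.
Qed.

(** * Binomial sums and the criterion at odd primes *)

Lemma sum_bin_mul_eq (r j : nat) :
  (\sum_(k < r.+1) 'C(r, k) * (k == j :> nat) = 'C(r, j))%N.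
Proof.
have [rj|jr] := ltnP r j.
  rewrite bin_small // big1 // => k _.
  by rewrite ltn_eqF ?muln0 // (leq_trans (ltn_ord k)).
rewrite (bigD1 (Ordinal (jr : (j < r.+1)%N))) //= eqxx muln1 big1 ?addn0 // => k.
by rewrite -val_eqE /= => /negPf->; rewrite muln0.
Qed.

(** Since [s + k] lies between 1 and [2 * n], the only multiples of [n] it can meet are [n] and
    [2 * n], the latter only for [s = k = n]. *)
Lemma sum_bin_dvdn (n r s : nat) :
  (0 < r)%N -> (r <= n)%N -> (0 < s)%N -> (s <= n)%N ->
  (\sum_(k < r.+1) 'C(r, k) * (n %| s + k) = 'C(r, n - s) + (s == n) * 'C(r, n))%N.
Proof.
move=> r0 rn s0 sn; rewrite -!sum_bin_mul_eq big_distrr -big_split /=.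
apply: eq_bigr => k _; rewrite [(_ * ('C(_, _) * _))%N]mulnCA -mulnDr; congr (_ * _)%N.
have kr := ltn_ord k; rewrite ltnS in kr.
have [d|nd] := boolP (n %| s + k)%N.
  have /dvdnP[q qE] := d.
  case: q qE => [|[|[|q]]] qE; last by nia.
  - by lia.
  - have -> : (k == n - s :> nat)%N by apply/eqP; lia.
    by case: eqP => //= sn'; case: eqP => // kn; lia.
  - by lia.
case: eqP => [kE|_]; first by move: nd; rewrite kE subnKC // dvdnn.
case: (eqVneq s n) => //= sE; case: eqP => // kE.
by move: nd; rewrite sE kE dvdn_addl ?dvdnn.
Qed.

Lemma prime_dvdn_fact (p n : nat) : prime p -> (p %| n`!)%N -> (p <= n)%N.
Proof.
move=> p_pr; elim: n => [|n IH]; first by rewrite dvdn1 => /eqP p1; rewrite p1 in p_pr.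
by rewrite factS Euclid_dvdM // => /orP[/dvdn_leq->//|/IH/leqW].
Qed.

Lemma prime_dvdn_bin (p n m : nat) :
  prime p -> (n < p)%N -> (m <= n)%N -> ~~ (p %| 'C(n, m))%N.
Proof.
move=> p_pr np mn; apply: contraL np => pC; rewrite -leqNgt prime_dvdn_fact //.
by rewrite -(bin_fact mn) dvdn_mulr.
Qed.

Lemma sum_bin_dvdn_mod (p r s : nat) : prime p -> (2 < p)%N ->
  (0 < r)%N -> (r <= p.-1)%N -> (0 < s)%N -> (s <= p.-1)%N ->
  (p %| \sum_(k < r.+1) 'C(r, k) * (p.-1 %| s + k))%N = (r + s < p.-1)%N.
Proof.
move=> p_pr p2 r0 rp s0 sp; rewrite sum_bin_dvdn //.
have [rs|rs] := ltnP (r + s) p.-1.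
  rewrite !bin_small ?muln0 ?addn0 ?dvdn0 //; lia.
have [->|sn] := eqVneq s p.-1.
  (* For [s = p.-1] the value is 2 or 1 according as [r = p.-1] or not, and neither is divisible by
     [p > 2]. *)
  rewrite subnn bin0 mul1n.
  have [->|rn] := eqVneq r p.-1; first by rewrite binn gtnNdvd.
  by rewrite bin_small ?gtnNdvd //; lia.
rewrite mul0n addn0; apply/negbTE/prime_dvdn_bin => //; lia.
Qed.

(** Expanding [(x + 1) ^+ r] and summing over [x] first gives minus the binomial sum of
    [sum_bin_dvdn_mod]; the exponents [s + k] are positive, as [sum_expf] demands. *)
Lemma sum_expf_mul_eq0 (p r s : nat) : prime p -> (2 < p)%N ->
  (0 < r)%N -> (r <= p.-1)%N -> (0 < s)%N -> (s <= p.-1)%N ->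
  (\sum_(x : 'F_p) (x + 1) ^+ r * x ^+ s == 0) = (r + s < p.-1)%N.
Proof.
move=> p_pr p2 r0 rp s0 sp; rewrite -(@sum_bin_dvdn_mod p) //.
rewrite (dvdn_pcharf (pchar_Fp p_pr)) natr_sum -[RHS]oppr_eq0 -sumrN; congr (_ == 0).
under eq_bigr => x _ do rewrite exprD1n mulr_suml.
rewrite exchange_big /=; apply: eq_bigr => k _.
under eq_bigr => x _ do rewrite mulrnAl -exprD.
rewrite sumrMnl sum_expf ?addn_gt0 ?s0 ?orbT // card_Fp // addnC.
by rewrite mulNrn natrM mulr_natl.
Qed.

Lemma lpres_spec (n m : nat) : (0 < m)%N ->
  [/\ (0 < lpres n m)%N, (lpres n m <= m)%N & lpres n m = n %[mod m]].
Proof.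
move=> m0; have /(_ erefl)[? ? /esym] := (lpresP n (lpres n m) m0).1.
by rewrite !modz_nat => -[].
Qed.

Lemma lpres_small (n m : nat) : (0 < n)%N -> (n <= m)%N -> lpres n m = n.
Proof. by move=> n0 nm; apply/lpresP => //; apply: leq_trans nm. Qed.

Lemma pintegral_bernoulli_rs_odd (p r s : nat) : prime p -> (2 < p)%N ->
  (0 < r)%N -> (0 < s)%N ->
  pintegral p (bernoulli_rs r s) = (lpres r (p - 1) + lpres s (p - 1) < p - 1)%N.
Proof.
move=> p_pr p2 r0 s0.
rewrite (@pintegral_bernoulli_rs (fun m => \sum_(a < p) a ^ m)%N) //; last first.
  move=> m; rewrite natr_sum; under eq_bigr => a _ do rewrite natrX.
  exact: pcong_bernoulli_num_odd.
have m0 : (0 < p - 1)%N by rewrite subn_gt0 ltnW.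
have [r1 rp rE] := lpres_spec r m0; have [s1 sp sE] := lpres_spec s m0.
rewrite subn1 in r1 rp rE s1 sp sE *; rewrite -sum_expf_mul_eq0 //.
rewrite (dvdn_pcharf (pchar_Fp p_pr)) natr_sum; congr (_ == 0).
(* The sum is folded back into a product of powers because the coefficients ['C(r, k)] are not
   periodic in [r], whereas the powers in ['F_p] are periodic for positive exponents. *)
transitivity (\sum_(x : 'F_p) (x + 1) ^+ r * x ^+ s).
  under [RHS]eq_bigr => x _ do rewrite exprD1n mulr_suml.
  rewrite exchange_big /=; apply: eq_bigr => k _.
  rewrite natrM natr_sum sum_natr_Fp // mulr_sumr; apply: eq_bigr => a _.
  by rewrite [in RHS]mulrnAl -exprD addnC natrX mulr_natl.
apply: eq_bigr => x _; congr (_ * _); apply: expf_card_mod; by rewrite ?card_Fp.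
Qed.

(** * The criterion at the prime 2 *)

Lemma sum_binS (f : nat -> nat) (r : nat) :
  (\sum_(k < r.+2) 'C(r.+1, k) * f k = \sum_(k < r.+1) 'C(r, k) * (f k + f k.+1))%N.
Proof.
under [RHS]eq_bigr do rewrite mulnDr.
rewrite big_split /= [LHS]big_ord_recl bin0 mul1n.
under [X in (_ + X)%N = _]eq_bigr do rewrite lift0 binS mulnDl.
rewrite big_split /= addnA; congr (_ + _)%N.
rewrite big_ord_recr /= bin_small // mul0n addn0.
by rewrite [RHS]big_ord_recl bin0 mul1n.
Qed.

(** By Pascal's rule each ['C(r, k)] is counted at the two consecutive indices [k] and [k.+1],
    exactly one of which has the right parity; what remains is the full row sum. *)
Lemma sum_bin_even (r s : nat) :
  (\sum_(k < r.+2) 'C(r.+1, k) * ~~ odd (s + k) = 2 ^ r)%N.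
Proof.
rewrite (sum_binS (fun k => ~~ odd (s + k) : nat)) -[2%N]/(1 + 1)%N expnDn.
by apply: eq_bigr => k _; rewrite !exp1n addnS /= negbK; case: (odd _).
Qed.

Lemma pintegral_bernoulli_rs2 (r s : nat) : (0 < r)%N -> (0 < s)%N ->
  pintegral 2 (bernoulli_rs r s) = (eps2 r s == 0%N).
Proof.
case: r => // r _; case: s => // s _.
pose c m : nat := (m == 1%N) || (0 < m)%N && ~~ odd m.
rewrite (@pintegral_bernoulli_rs c) //; last exact: pcong_bernoulli_num2.
rewrite {}/c.
(* The indicator is that of even numbers, corrected at the single index 1, which is reached only
   when [s] and [k] both vanish. *)
have cE k : (((s.+1 + k == 1) || (0 < s.+1 + k) && ~~ odd (s.+1 + k)) =
             ~~ odd (s.+1 + k) + (s == 0) * (k == 0) :> nat)%N.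
  by case: s k => [|s] [|k] //=; rewrite ?addn0 //; case: (odd _).
under eq_bigr do rewrite cE mulnDr mulnCA.
rewrite big_split (sum_bin_even r s.+1) -big_distrr /= sum_bin_mul_eq bin0 muln1.
(* With both arguments lowered by 1, the sum is [2 ^ r + (s == 0)], which is odd iff exactly one of
   [r], [s] is 0. *)
rewrite dvdn2 oddD oddX orbF /eps2 !eqSS.
by case: r s {cE} => [|r] [|s].
Qed.

(** * Exponents in products of distinct primes, and the final assembly *)

Lemma prod_primes_gt0 (l : seq nat) : all prime l -> (0 < \prod_(p <- l) p)%N.
Proof.
elim: l => [|p l IH] /=; first by rewrite big_nil.
by case/andP=> /prime_gt0 p0 /IH; rewrite big_cons muln_gt0 p0.
Qed.

Lemma logn_prod_primes (q : nat) (l : seq nat) : uniq l -> all prime l ->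
  logn q (\prod_(p <- l) p)%N = (q \in l).
Proof.
elim: l => [|p l IH] /=; first by rewrite big_nil logn1.
move=> /andP[pl ul] /andP[p_pr l_pr]; rewrite big_cons.
rewrite lognM ?(prime_gt0 p_pr) ?prod_primes_gt0 //.
rewrite logn_prime // IH // inE; case: eqP => [->|//].
by rewrite (negPf pl).
Qed.

Theorem theorem1p3 :
  (forall r s : nat, (1 <= r)%N -> (1 <= s)%N ->
     denom_rs r s =
       (2 ^ eps2 r s * 3 *
        \prod_(5 <= p < (r + s + 1).+1 |
                 prime p && (p - 1 <= lpres (Posz r) (p - 1) + lpres (Posz s) (p - 1)))
           p)%N)
  /\ (forall n : nat,
        denom_rs n 0 = denom (bernoulli_num n) /\
        denom_rs 0 n = denom (bernoulli_num n))
  /\ (forall r s : nat, squarefree (denom_rs r s))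
  /\ (forall r s : nat, denom_rs r s = denom_rs s r).
Proof.
split; last split; last split; last exact: denom_rsC.
- move=> r s r0 s0; rewrite /denom_rs -big_filter; set l := filter _ _.
  have l_pr : all prime l.
    by apply/allP => p; rewrite mem_filter => /andP[/andP[]].
  have l0 := prod_primes_gt0 l_pr.
  (* Both sides are compared through their exponents at each prime [q]. *)
  apply: eqn_from_log; rewrite ?denom_gt0 // ?muln_gt0 ?l0 ?expn_gt0 // => q.
  have [q_pr|q_npr] := boolP (prime q); last by rewrite [LHS]lognE [RHS]lognE (negPf q_npr).
  rewrite logn_denom ?pintegral_bernoulli_rs_mul // !lognM ?muln_gt0 ?expn_gt0 //.
  rewrite logn_prod_primes ?filter_uniq ?iota_uniq // lognX !logn_prime //.
  rewrite mem_filter q_pr mem_index_iota /=.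
  have [q2|q2] := ltnP 2 q; last first.
    have -> : q = 2%N by have := prime_gt1 q_pr; lia.
    rewrite pintegral_bernoulli_rs2 // andbF !addn0 muln1 /eps2.
    by case: ifP.
  rewrite pintegral_bernoulli_rs_odd // -leqNgt (gtn_eqF q2) muln0 add0n.
  have [->|q3] := eqVneq q 3%N.
    (* Modulo [q - 1 = 2] both residues are at least 1, so the condition always holds and 3 always
       divides the denominator. *)
    have [r1 _ _] := @lpres_spec r 2 isT; have [s1 _ _] := @lpres_spec s 2 isT.
    by rewrite subn1 (leq_add r1 s1).
  have q4 : (4 < q)%N.
    by case: q q_pr q2 q3 => [|[|[|[|[|q]]]]].
  rewrite q4 add0n /=; case: leqP => qrs; last by rewrite andbT.
  (* Here [q > r + s + 1], so [r] and [s] are their own residues and their sum is below [q - 1]: the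
     upper bound of the product omits no prime that satisfies the residue condition. *)
  by rewrite andbF !lpres_small //; lia.
- by move=> n; rewrite denom_rsC /denom_rs bernoulli_rs0l.
move=> r s d; rewrite /denom_rs => dd; apply/eqP; rewrite eqn_leq andbC.
have d0 : (0 < d)%N by move: dd; case: d => //; rewrite dvd0n gtn_eqF // denom_gt0.
rewrite d0 leqNgt; apply/negP => d1.
(* A prime factor of [d] would have exponent at least 2 in the denominator, against [logn_denom]. *)
have p_pr := pdiv_prime d1.
have : (2 <= logn (pdiv d) (denom (bernoulli_rs r s)))%N.
  by rewrite -pfactor_dvdn ?denom_gt0 // (dvdn_trans _ dd) // dvdn_exp2r // pdiv_dvd.
by rewrite logn_denom ?pintegral_bernoulli_rs_mul //; case: (~~ _).
Qed.
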